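(* Let $n\ge 2$ be an integer and let $\phi:\mathfrak l\to\mathfrak{gl}(n,\mathbb R)$ be the inclusion of $\mathfrak l$ as a Lie algebra of $n\times n$ matrices, regarded as a representation of $\mathfrak l$ in $\mathbb R^n$. Then for every $y\in\mathfrak l$, $$M^*\phi(y)M=\begin{pmatrix}0&0\\0&\phi_1(y)\end{pmatrix},\qquad \phi_1(y)=M_1^*\phi(y)M_1,$$ and $\phi_1$ is a faithful representation of $\mathfrak l$ in $\mathbb R^{n-1}$; thus $\phi$ is isomorphic to the direct sum of the faithful representation $\phi_1$ in $\mathbb R^{n-1}$ and the null $1$-dimensional representation. Moreover, $\phi_1$ maps $\mathcal H$ isomorphically onto the space of traceless diagonal $(n-1)\times(n-1)$ real matrices, and $\phi_1(\mathcal A)$ is the space of $(n-1)\times(n-1)$ real matrices with vanishing diagonal.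
   Context: Fix an orthonormal basis $v_1,\ldots,v_{n-1}$ of the hyperplane $\{x\in\mathbb R^n: x_1+\cdots+x_n=0\}$ and set $v_0=\frac1{\sqrt n}(1,\ldots,1)\in\mathbb R^n$. For $a,b\in\mathbb R^n$, $a\otimes b$ denotes the $n\times n$ matrix $(a_ib_j)_{i,j}$. Set $$\mathcal A=\mathrm{span}\{v_i\otimes v_j: 1\le i,j\le n-1,\ i\neq j\},\qquad \mathcal H=\Big\{\sum_{\ell=1}^{n-1}\gamma_\ell\,(v_\ell\otimes v_\ell): \gamma_\ell\in\mathbb R,\ \sum_{\ell=1}^{n-1}\gamma_\ell=0\Big\},\qquad \mathfrak l=\mathcal A\oplus\mathcal H,$$ a Lie algebra under the matrix commutator. $M\in\mathbb R^{n\times n}$ is the (orthogonal) matrix with columns $v_0,v_1,\ldots,v_{n-1}$, and $M_1\in\mathbb R^{n\times(n-1)}$ is the matrix with columns $v_1,\ldots,v_{n-1}$. The superscript $^*$ denotes transpose. *)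

(* Defs.v *)
From HB Require Import structures.
From mathcomp Require Import all_boot all_order all_algebra.
From mathcomp Require Import all_classical reals.

Set Implicit Arguments.
Unset Strict Implicit.
Unset Printing Implicit Defensive.

Import Order.TTheory GRing.Theory Num.Theory.
Local Open Scope ring_scope.

Section LieRepresentations.
Variable R : fieldType.

Definition bracket n (x y : 'M[R]_n) : 'M[R]_n := x *m y - y *m x.

Definition lie_subalgebra n (L : {vspace 'M[R]_n}) : Prop :=
  forall x y, x \in L -> y \in L -> bracket x y \in L.

(* The commutator as an operation on the elements of L; vsproj L is a left
   inverse of the inclusion vsval, so this is the commutator itself as soon as
   L is a Lie subalgebra. *)
Definition sub_bracket n (L : {vspace 'M[R]_n}) (x y : subvs_of L) :
  subvs_of L := vsproj L (bracket (vsval x) (vsval y)).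

Definition lie_representation n (L : {vspace 'M[R]_n}) k
    (f : subvs_of L -> 'M[R]_k) : Prop :=
  [/\ lie_subalgebra L,
      linear f &
      forall x y, f (sub_bracket x y) = bracket (f x) (f y)].

Definition faithful_representation n (L : {vspace 'M[R]_n}) k
    (f : subvs_of L -> 'M[R]_k) : Prop :=
  lie_representation f /\ injective f.

Definition null_rep n (L : {vspace 'M[R]_n}) k : subvs_of L -> 'M[R]_k :=
  fun=> 0.

Definition dsum_rep n (L : {vspace 'M[R]_n}) k l
    (f : subvs_of L -> 'M[R]_k) (g : subvs_of L -> 'M[R]_l) :
    subvs_of L -> 'M[R]_(k + l) :=
  fun y => block_mx (f y) 0 0 (g y).

Definition iso_rep n (L : {vspace 'M[R]_n}) k l
    (f : subvs_of L -> 'M[R]_k) (g : subvs_of L -> 'M[R]_l) : Prop :=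
  [/\ lie_representation f,
      lie_representation g &
      exists T : {linear 'cV[R]_k -> 'cV[R]_l},
        bijective T /\ forall y u, T (f y *m u) = g y *m T u].

End LieRepresentations.

Section Statement.
Variable R : realType.

Definition dotv n (a b : 'cV[R]_n) : R := \sum_i a i 0 * b i 0.

Definition tensor n (a b : 'cV[R]_n) : 'M[R]_n :=
  \matrix_(i, j) (a i 0 * b j 0).

Definition hyperplane n : {vspace 'cV[R]_n} :=
  lker (linfun (mulmx (const_mx 1 : 'rV[R]_n)) : 'Hom('cV[R]_n, 'cV[R]_1)).

Lemma mem_hyperplane n (x : 'cV[R]_n) :
  (x \in hyperplane n) = (\sum_i x i 0 == 0).
Proof.
rewrite memv_ker lfunE /=.
have -> : const_mx 1 *m x = (\sum_i x i 0)%:M :> 'M_1.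
  apply/matrixP=> i j; rewrite !ord1 !mxE mulr1n.
  by apply: eq_bigr => k _; rewrite mxE mul1r.
apply/eqP/eqP => [/matrixP/(_ 0 0)|->]; first by rewrite !mxE mulr1n.
by rewrite raddf0.
Qed.

(* In this section the index i : 'I_n.-1 (values 0, ..., n-2) stands for the
   mathematical index i + 1, so v i is the (i+1)-st basis vector. *)
Definition orthonormal_basis n (v : 'I_n.-1 -> 'cV[R]_n) : Prop :=
  basis_of (hyperplane n) [seq v i | i : 'I_n.-1] /\
  forall i j, dotv (v i) (v j) = (i == j)%:R.

Definition v0 n : 'cV[R]_n := (Num.sqrt n%:R)^-1 *: const_mx 1.

Section Basis.
Variables (n : nat) (v : 'I_n.-1 -> 'cV[R]_n).

Definition calA : {vspace 'M[R]_n} :=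
  <<[seq tensor (v p.1) (v p.2) | p : 'I_n.-1 * 'I_n.-1 in
       [pred p | p.1 != p.2]]>>%VS.

Definition diag_tensor (gamma : 'cV[R]_n.-1) : 'M[R]_n :=
  \sum_l gamma l 0 *: tensor (v l) (v l).

Lemma diag_tensor_linear : linear diag_tensor.
Proof.
move=> a x y; rewrite /diag_tensor scaler_sumr -big_split /=.
by apply: eq_bigr => l _; rewrite !mxE scalerDl scalerA.
Qed.

HB.instance Definition _ :=
  GRing.isLinear.Build R 'cV[R]_n.-1 'M[R]_n *:%R diag_tensor
    diag_tensor_linear.

(* The coefficient vectors with zero sum are those of hyperplane n.-1; see
   mem_calH for the set-builder form. *)
Definition calH : {vspace 'M[R]_n} :=
  (linfun diag_tensor @: hyperplane n.-1)%VS.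

Lemma mem_calH (y : 'M[R]_n) :
  y \in calH <->
  exists gamma : 'I_n.-1 -> R,
    \sum_l gamma l = 0 /\ y = \sum_l gamma l *: tensor (v l) (v l).
Proof.
split=> [/memv_imgP[g /[!mem_hyperplane] /eqP g0 ->]|[g [g0 ->]]].
  by exists (fun l => g l 0); rewrite lfunE.
apply/memv_imgP; exists (\col_l g l).
  rewrite mem_hyperplane -[X in _ == X]g0; apply/eqP.
  by apply: eq_bigr => l _; rewrite mxE.
by rewrite lfunE /= /diag_tensor; apply: eq_bigr => l _; rewrite mxE.
Qed.

(* The sum is direct for an orthonormal v: see calA_calH_direct. *)
Definition lie_l : {vspace 'M[R]_n} := (calA + calH)%VS.

Lemma calA_calH_direct : orthonormal_basis v -> directv (calA + calH).
Proof.
move=> [_ von]; apply/directv_addP/eqP; rewrite -subv0; apply/subvP => y.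
rewrite memv_cap memv0 => /andP[yA /mem_calH[g [_ yE]]].
pose q l : {linear 'M[R]_n -> 'M[R]_1} := mulmx (v l)^T \o mulmxr (v l).
have dotE a b : a^T *m b = (dotv a b)%:M :> 'M[R]_1.
  apply/matrixP => i j; rewrite !ord1 !mxE mulr1n.
  by apply: eq_bigr => k _; rewrite mxE.
have tensorE a b : tensor a b = a *m b^T.
  by apply/matrixP => i j; rewrite !mxE big_ord1 mxE.
have q_tensor l i j :
    q l (tensor (v i) (v j)) = ((l == i)%:R * (j == l)%:R)%:M.
  rewrite /= tensorE -[_ *m v l]mulmxA [LHS]mulmxA (dotE _ (v l) (v i)).
  by rewrite (dotE _ (v j)) !von -scalar_mxM.
have qA l : q l y = 0.
  have sA : (calA <= lker (linfun (q l)))%VS.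
    apply/span_subvP => x /mapP[[i j]]; rewrite mem_enum inE /= => ij ->.
    rewrite memv_ker lfunE q_tensor.
    have [li|_] := eqVneq l i; last by rewrite mul0r raddf0.
    by rewrite li [j == i]eq_sym (negbTE ij) mulr0 raddf0.
  by move/subvP: sA => /(_ y yA); rewrite memv_ker lfunE => /eqP.
apply/eqP; rewrite yE big1 // => l _.
have : q l y = (g l)%:M.
  rewrite yE linear_sum (bigD1 l) // big1 => [|k kl].
    rewrite [LHS]addr0 linearZ q_tensor eqxx mulr1.
    by rewrite /= scale_scalar_mx mulr1.
  by rewrite linearZ q_tensor (negbTE kl) mulr0 raddf0 /= scaler0.
rewrite qA => /matrixP/(_ 0 0); rewrite !mxE mulr1n => <-.
by rewrite scale0r.
Qed.

Definition M1 : 'M[R]_(n, n.-1) := \matrix_(i, l) v l i 0.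

(* The column count 1 + n.-1 equals n for n > 0; this form gives the block
   decomposition of M^T *m y *m M without a cast. *)
Definition M : 'M[R]_(n, 1 + n.-1) := row_mx (v0 n) M1.

Definition phi (y : subvs_of lie_l) : 'M[R]_n := vsval y.

Definition phi1 (y : subvs_of lie_l) : 'M[R]_n.-1 := M1^T *m phi y *m M1.

End Basis.
End Statement.

Arguments phi {R n} v y.
Arguments phi1 {R n} v y.

(* Main.v *)
(** Since M1^* M1 = 1, the map B |-> M1 B M1^* is an injective morphism of
    matrix algebras with left inverse y |-> M1^* y M1.  It sends the
    zero-diagonal matrices onto A, the traceless diagonal ones onto H, hence
    sl(n-1) onto l, so that phi1 is the inverse isomorphism from l to sl(n-1).
    The null summand comes from v0, which is orthogonal to the columns of M1. *)
From HB Require Import structures.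
Require Import Defs.
From mathcomp Require Import all_boot all_order all_algebra.
From mathcomp Require Import all_classical reals.
Import GRing.Theory Num.Theory.
Local Open Scope ring_scope.
Local Open Scope classical_set_scope.

(** Serves to describe the elements of [calA], which is given only by spanning tensors. *)
Lemma span_ind {K : fieldType} {V : vectType K} {X : seq V} (P : V -> Prop) :
  P 0 -> (forall a x y, P x -> P y -> P (a *: x + y)) ->
  (forall x, x \in X -> P x) -> forall x, x \in <<X>>%VS -> P x.
Proof.
move=> P0 Plin PX x /(@coord_span _ _ _ (in_tuple X)) ->.
elim/big_rec: _ => // i y _ Py; apply: Plin Py; apply: PX.
by rewrite mem_nth.
Qed.

Lemma mxtrace_bracket {K : fieldType} {n} (x y : 'M[K]_n) :
  \tr (bracket x y) = 0.
Proof. by rewrite linearB /= mxtrace_mulC subrr. Qed.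

Lemma phi_lie_representation {R : realType} {n} (v : 'I_n.-1 -> 'cV[R]_n) :
  lie_subalgebra (lie_l v) -> lie_representation (phi v).
Proof.
move=> subl; split=> [//|a x y|x y]; first by rewrite /phi linearP.
by rewrite /phi /sub_bracket vsprojK //; apply: subl; apply: subvsP.
Qed.

(** * The spaces [calA], [calH] and [lie_l] as images under [emb] *)

Section Embedding.
Variables (R : realType) (n : nat) (v : 'I_n.-1 -> 'cV[R]_n).

Definition emb (B : 'M[R]_n.-1) : 'M[R]_n := M1 v *m B *m (M1 v)^T.

Fact emb_is_linear : linear emb.
Proof.
by move=> a B C; rewrite /emb mulmxDr mulmxDl -scalemxAr -scalemxAl.
Qed.

HB.instance Definition _ :=
  GRing.isLinear.Build R 'M[R]_n.-1 'M[R]_n *:%R emb emb_is_linear.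

Lemma emb_delta i j : emb (delta_mx i j) = tensor (v i) (v j).
Proof.
(* A matrix unit is a standard column times a standard row, so [emb] turns it into [v i] times the
   transpose of [v j]. *)
rewrite /emb -(mul_delta_mx (0 : 'I_1)) mulmxA -mulmxA -colE -rowE.
by apply/matrixP => k l; rewrite !mxE big_ord1 !mxE.
Qed.

Lemma emb_sum B :
  emb B = \sum_i \sum_j B i j *: tensor (v i) (v j).
Proof.
rewrite [in LHS](matrix_sum_delta B) linear_sum; apply: eq_bigr => i _.
by rewrite linear_sum; apply: eq_bigr => j _; rewrite linearZ /= emb_delta.
Qed.

Lemma emb_diag d : emb (diag_mx d) = \sum_l d 0 l *: tensor (v l) (v l).
Proof.
rewrite emb_sum; apply: eq_bigr => i _.
rewrite (bigD1 i) //= mxE eqxx mulr1n big1 ?addr0 // => j ji.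
by rewrite mxE eq_sym (negbTE ji) mulr0n scale0r.
Qed.

Lemma mem_calA y :
  y \in calA v <-> exists2 B : 'M[R]_n.-1, (forall i, B i i = 0) & y = emb B.
Proof.
split=> [|[B B0 ->]].
  apply: (span_ind (fun y =>
    exists2 B : 'M[R]_n.-1, (forall i, B i i = 0) & y = emb B)).
  - by exists 0; [move=> i; rewrite mxE | rewrite linear0].
  - move=> a _ _ [B B0 ->] [C C0 ->]; exists (a *: B + C); last first.
      by rewrite linearP.
    by move=> i; rewrite !mxE B0 C0 mulr0 addr0.
  - move=> _ /mapP[[i j] + ->] /=; rewrite mem_enum inE /= => ij.
    exists (delta_mx i j); last by rewrite emb_delta.
    move=> k; rewrite mxE; case: eqVneq => //= ->.
    by rewrite (negbTE ij).
rewrite emb_sum; apply: memv_suml => i _; apply: memv_suml => j _.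
have [<-|ij] := eqVneq i j; first by rewrite B0 scale0r mem0v.
apply/memvZ/memv_span/mapP; exists (i, j) => //.
by rewrite mem_enum inE.
Qed.

Lemma mem_calH_diag y :
  y \in calH v <->
  exists2 d : 'rV[R]_n.-1, \tr (diag_mx d) = 0 & y = emb (diag_mx d).
Proof.
rewrite mem_calH; split=> [[g [g0 ->]]|[d d0 ->]].
  exists (\row_l g l).
    by rewrite mxtrace_diag -[RHS]g0; apply: eq_bigr => l _; rewrite mxE.
  by rewrite emb_diag; apply: eq_bigr => l _; rewrite mxE.
by exists (d 0); rewrite -mxtrace_diag -emb_diag.
Qed.

Lemma mem_lie_l y :
  y \in lie_l v <-> exists2 B : 'M[R]_n.-1, \tr B = 0 & y = emb B.
Proof.
split=> [/memv_addP[a /mem_calA[B B0 ->] [h /mem_calH_diag[d d0 ->] ->]]|].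
  exists (B + diag_mx d); last by rewrite linearD.
  by rewrite linearD /= d0 addr0 /mxtrace big1.
(* The off-diagonal part of [B] gives the summand in [calA]; the diagonal [d] carries the whole
   trace and gives the summand in [calH]. *)
move=> [B B0 ->]; pose d := \row_i B i i.
rewrite -(subrK (diag_mx d) B) linearD /=; apply: memv_add.
  apply/mem_calA; exists (B - diag_mx d) => // i.
  by rewrite !mxE eqxx mulr1n subrr.
apply/mem_calH_diag; exists d => //.
by rewrite mxtrace_diag -[RHS]B0; apply: eq_bigr => i _; rewrite mxE.
Qed.

(** * Orthonormality, and [phi1] as the inverse of [emb] on [lie_l] *)

Hypothesis hv : orthonormal_basis v.

Lemma M1_orthonormal : (M1 v)^T *m M1 v = 1%:M.
Proof.
apply/matrixP => i j; rewrite !mxE -(hv.2 i j) /dotv.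
by apply: eq_bigr => k _; rewrite !mxE.
Qed.

Lemma v0_orthogonal_M1 : (v0 R n)^T *m M1 v = 0.
Proof.
apply/matrixP => i j; rewrite !mxE.
have : v j \in hyperplane R n.
  by apply: (basis_mem hv.1); apply: map_f; rewrite mem_enum.
rewrite mem_hyperplane => /eqP v_sum.
transitivity ((Num.sqrt n%:R)^-1 * \sum_k v j k 0);
  last by rewrite v_sum mulr0.
by rewrite mulr_sumr; apply: eq_bigr => k _; rewrite !mxE mulr1.
Qed.

Lemma M1_orthogonal_v0 : (M1 v)^T *m v0 R n = 0.
Proof. by rewrite -[LHS]trmxK trmx_mul trmxK v0_orthogonal_M1 trmx0. Qed.

Lemma embM B C : emb B *m emb C = emb (B *m C).
Proof.
by rewrite /emb !mulmxA -[_ *m _^T *m M1 v]mulmxA M1_orthonormal mulmx1.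
Qed.

Lemma emb_bracket B C : bracket (emb B) (emb C) = emb (bracket B C).
Proof. by rewrite /bracket !embM linearB. Qed.

Lemma embK B : (M1 v)^T *m emb B *m M1 v = B.
Proof.
rewrite /emb !mulmxA M1_orthonormal mul1mx.
by rewrite -mulmxA M1_orthonormal mulmx1.
Qed.

(** The bracket of two images under [emb] is the image of a commutator, which has trace zero. *)
Lemma lie_l_subalgebra : lie_subalgebra (lie_l v).
Proof.
move=> _ _ /mem_lie_l[B B0 ->] /mem_lie_l[C C0 ->].
rewrite emb_bracket; apply/mem_lie_l; exists (bracket B C) => //.
exact: mxtrace_bracket.
Qed.

(** The left side is [y] multiplied on both sides by the projection [M1 v *m (M1 v)^T]; this fixes
    [y] because [y] lies in the image of [emb]. *)
Lemma phi1K (y : subvs_of (lie_l v)) : emb (phi1 v y) = vsval y.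
Proof.
by have /mem_lie_l[B _ yE] := subvsP y; rewrite /phi1 /phi yE embK.
Qed.

(** Reduces each identity for [phi1] to one for [emb]. *)
Lemma phi1_emb (y : subvs_of (lie_l v)) B : vsval y = emb B -> phi1 v y = B.
Proof. by rewrite /phi1 /phi => ->; rewrite embK. Qed.

Lemma phi1_inj : injective (phi1 v).
Proof.
move=> x y xy; apply: val_inj; change (vsval x = vsval y).
by rewrite -!phi1K xy.
Qed.

Lemma phi1_faithful : faithful_representation (phi1 v).
Proof.
split; last exact: phi1_inj.
split=> [|a x y|x y]; first exact: lie_l_subalgebra.
  by apply: phi1_emb; rewrite linearP /= -!phi1K -linearP.
apply: phi1_emb; rewrite -emb_bracket !phi1K.
(* Closure of [lie_l] under the bracket makes [sub_bracket] the true commutator. *)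
by rewrite vsprojK //; apply: lie_l_subalgebra; apply: subvsP.
Qed.

(** * The null summand spanned by [v0] *)

Lemma emb_v0 B : emb B *m v0 R n = 0.
Proof. by rewrite /emb -mulmxA M1_orthogonal_v0 mulmx0. Qed.

Lemma v0_emb B : (v0 R n)^T *m emb B = 0.
Proof. by rewrite /emb !mulmxA v0_orthogonal_M1 !mul0mx. Qed.

Lemma conj_M_phi (y : subvs_of (lie_l v)) :
  (M v)^T *m phi v y *m M v = block_mx 0 0 0 (phi1 v y).
Proof.
(* With [y] written as [emb (phi1 v y)], every block involving [v0] vanishes. *)
rewrite /M tr_row_mx mul_col_mx mul_col_row /phi1 /phi -phi1K.
by rewrite v0_emb -[_ *m _ *m v0 R n]mulmxA emb_v0 !mul0mx mulmx0.
Qed.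

Lemma v0_normal : (0 < n)%N -> (v0 R n)^T *m v0 R n = 1%:M.
Proof.
move=> n_gt0; apply/matrixP => i j; rewrite !ord1 !mxE.
under eq_bigr do rewrite !mxE mulr1 -expr2 exprVn sqr_sqrtr ?ler0n //.
by rewrite sumr_const card_ord -[LHS]mulr_natl mulfV // pnatr_eq0 -lt0n.
Qed.

Lemma M_orthogonal : (0 < n)%N -> M v *m (M v)^T = 1%:M.
Proof.
move=> n_gt0; have MTM : (M v)^T *m M v = 1%:M.
  rewrite /M tr_row_mx mul_col_row v0_normal // v0_orthogonal_M1.
  by rewrite M1_orthogonal_v0 M1_orthonormal -scalar_mx_block.
(* A left inverse is a right inverse only for square matrices; the column count is generalized so
   that it can be replaced by [n]. *)
have: (1 + n.-1 = n)%N by rewrite add1n prednK.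
move: (M v) MTM; move: (1 + n.-1)%N => m A + mn.
by move: A; rewrite mn => A; apply: mulmx1C.
Qed.

Lemma phi_iso_dsum :
  (0 < n)%N -> iso_rep (phi v) (dsum_rep (phi1 v) (null_rep (L := lie_l v) 1)).
Proof.
move=> n_gt0; have [[_ phi1_lin phi1_br] _] := phi1_faithful.
split; first exact/phi_lie_representation/lie_l_subalgebra.
  split=> [|a x y|x y]; first exact: lie_l_subalgebra.
    rewrite /dsum_rep /null_rep phi1_lin scale_block_mx add_block_mx.
    by rewrite !scaler0 !addr0.
  rewrite /dsum_rep /null_rep phi1_br /bracket !mulmx_block opp_block_mx.
  by rewrite add_block_mx !(mulmx0, mul0mx, addr0, subr0).
(* [dsum_rep] puts the null summand last, so [v0] becomes the last column, unlike in [M]. *)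
pose P := row_mx (M1 v) (v0 R n).
have PTP : P^T *m P = 1%:M.
  rewrite /P tr_row_mx mul_col_row v0_normal // v0_orthogonal_M1.
  by rewrite M1_orthogonal_v0 M1_orthonormal -scalar_mx_block.
have PPT : P *m P^T = 1%:M.
  (* Both products are the sum of [M1 v *m (M1 v)^T] and [v0 R n *m (v0 R n)^T], in opposite
     orders. *)
  rewrite -(M_orthogonal n_gt0) /P /M !tr_row_mx !mul_row_col.
  exact: addrC.
exists (mulmx P^T); split=> [|y u].
  by exists (mulmx P) => u; rewrite /= mulmxA ?PPT ?PTP mul1mx.
change (P^T *m (phi v y *m u) =
        dsum_rep (phi1 v) (null_rep (L := lie_l v) 1) y *m (P^T *m u)).
rewrite !mulmxA; congr (_ *m u).
(* The lower block is zero on both sides; the upper one says [(M1 v)^T *m emb B = B *m (M1 v)^T] for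
   [B] equal to [phi1 v y]. *)
rewrite /P tr_row_mx mul_col_mx /phi -phi1K v0_emb.
rewrite /dsum_rep /null_rep mul_block_col !mul0mx addr0 addr0.
by rewrite /emb !mulmxA M1_orthonormal mul1mx.
Qed.

(** * The images of [calH] and [calA] under [phi1] *)

Lemma phi1_calH :
  set_bij [set y : subvs_of (lie_l v) | vsval y \in calH v]
          [set D : 'M[R]_n.-1 | is_diag_mx D /\ \tr D = 0] (phi1 v).
Proof.
split=> [y /= /mem_calH_diag[d d0 /phi1_emb ->]||D /= [/diag_mxP[d ->] d0]].
- by rewrite diag_mx_is_diag.
- by move=> x y _ _; apply: phi1_inj.
(* The preimage is [emb (diag_mx d)]; its membership in [lie_l] is needed to form an element of the
   subtype. *)
- have dH : emb (diag_mx d) \in calH v by apply/mem_calH_diag; exists d.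
  have dl : emb (diag_mx d) \in lie_l v by apply: (subvP (addvSr _ _)).
  by exists (Subvs dl) => //=; apply: phi1_emb.
Qed.

Lemma phi1_calA :
  (phi1 v) @` [set y : subvs_of (lie_l v) | vsval y \in calA v] =
  [set B : 'M[R]_n.-1 | forall i, B i i = 0].
Proof.
apply/seteqP; split=> [_ [y /= /mem_calA[B B0 /phi1_emb ->] <-] //|B /= B0].
have BA : emb B \in calA v by apply/mem_calA; exists B.
have Bl : emb B \in lie_l v by apply: (subvP (addvSl _ _)).
by exists (Subvs Bl) => //=; apply: phi1_emb.
Qed.

End Embedding.

Theorem mainTheorem3 (R : realType) (n : nat) (hn : (2 <= n)%N)
    (v : 'I_n.-1 -> 'cV[R]_n) (hv : orthonormal_basis v) :
  [/\ forall y : subvs_of (lie_l v),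
        (M v)^T *m phi v y *m M v = block_mx 0 0 0 (phi1 v y),
      faithful_representation (phi1 v),
      iso_rep (phi v) (dsum_rep (phi1 v) (null_rep 1)),
      set_bij [set y : subvs_of (lie_l v) | vsval y \in calH v]
              [set D : 'M[R]_n.-1 | is_diag_mx D /\ \tr D = 0]
              (phi1 v) &
      (phi1 v) @` [set y : subvs_of (lie_l v) | vsval y \in calA v] =
      [set B : 'M[R]_n.-1 | forall i, B i i = 0]].
Proof.
split.
- exact: conj_M_phi.
- exact: phi1_faithful.
- exact: phi_iso_dsum (ltnW hn).
(* With the linearity contained in [phi1_faithful], this bijection is an isomorphism of vector
   spaces. *)
- exact: phi1_calH.
- exact: phi1_calA.
Qed.
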